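(* For $n\ge 1$, let $f_0(n)$ be the number of binary words (over $\{0,1\}$) of length $n-1$ in which $0$ appears only in runs of even length, and $1$ appears only in runs whose length is divisible by $3$. Then: (1) $f_0(1)=1$, $f_0(2)=0$, $f_0(3)=1$, and $f_0(n+3)=f_0(n+1)+f_0(n)$ for $n\ge 1$. (2) $f_0(n)=p_{n+2}$ for $n\ge 1$, where $p_n$ is the $n$th Padovan number.
   Context: A run is a maximal block of consecutive equal letters; the empty word is the unique word of length $0$. The Padovan numbers are indexed by $p_0=1$, $p_1=0$, $p_2=0$, and $p_{n+3}=p_{n+1}+p_n$ for $n\ge 0$ (so $p_3=1,p_4=0,p_5=1,p_6=1,p_7=1,p_8=2,\ldots$). *)

(* Defs.v *)
From mathcomp Require Import all_boot.

Set Implicit Arguments.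
Unset Strict Implicit.
Unset Printing Implicit Defensive.

(* Binary words are sequences of booleans: false is the letter 0 and true the
   letter 1.  A block is given by the half-open interval [i, j) of its
   positions in the word w, counted from 0. *)
Definition equal_block (w : seq bool) (i j : nat) : bool :=
  [&& i < j, j <= size w & constant (take (j - i) (drop i w))].

(* The bounded quantifiers lose nothing: any block has both of its endpoints
   at most size w. *)
Definition is_run (w : seq bool) (i j : nat) : bool :=
  equal_block w i j &&
  [forall i' : 'I_(size w).+1, forall j' : 'I_(size w).+1,
    [&& i' <= i, j <= j' & equal_block w i' j'] ==>
      (i' == i :> nat) && (j' == j :> nat)].

Definition runs_dvd (a : bool) (k : nat) (w : seq bool) : bool :=
  [forall i : 'I_(size w).+1, forall j : 'I_(size w).+1,
    is_run w i j && (nth false w i == a) ==> (k %| j - i)].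

Definition f0 (n : nat) : nat :=
  #|[set w : n.-1.-tuple bool | runs_dvd false 2 w && runs_dvd true 3 w]|.

Fixpoint padovan (n : nat) : nat :=
  match n with
  | 0 => 1
  | 1 => 0
  | 2 => 0
  | (m.+1 as m1).+2 => padovan m1 + padovan m
  end.

(* Main.v *)
Require Import Defs.
From mathcomp Require Import all_boot.
From mathcomp Require Import zify.

Set Implicit Arguments.
Unset Strict Implicit.
Unset Printing Implicit Defensive.

(** Call a word good when its runs of 0 have even length and its runs of 1 have
    length divisible by 3.  A good word is a concatenation of the tiles 00 and
    111, in exactly one way: its leading run is a non-empty multiple of the tile
    of its first letter, and removing one tile from the front, or adding one,
    changes only the leading run, by a length that the divisibility condition
    does not see.  Splitting the good words of length [m + 3] by their first
    letter hence gives the recurrence ([f0_rec]), and the Padovan numbers obey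
    the same recurrence from the same initial values.

    The work lies in deriving this from runs given as maximal intervals of
    positions.  Maximality is first turned into a condition on the two letters
    next to the interval ([is_runP]).  From it, the divisibility condition on
    [nseq l b ++ v], where [v] does not begin with [b], splits into a condition
    on [l] and the same condition on [v] ([runs_dvd_leading_run]); everything
    about tiles follows from this identity. *)

(** * Runs and the leading run of a word *)

Lemma equal_blockP (w : seq bool) (i j : nat) :
  reflect (i < j <= size w /\
           forall p, i <= p < j -> nth false w p = nth false w i)
          (equal_block w i j).
Proof.
rewrite /equal_block andbA.
case: (boolP (i < j <= size w)) => [/andP[ltij lejw]|nlt] /=; last first.
  by right; case.
have -> : take (j - i) (drop i w)
        = nth false w i :: take (j - i.+1) (drop i.+1 w).
  rewrite (drop_nth false); last exact: leq_trans ltij lejw.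
  by rewrite -(subnSK ltij).
apply: (iffP (all_nthP false)) => [eq_w | [_ eq_w] q].
  split=> // p /andP[]; rewrite leq_eqVlt => /predU1P[<- // | ltip] ltpj.
  have := eq_w (p - i.+1).
  rewrite size_takel ?size_drop; last by lia.
  rewrite nth_take ?nth_drop; last by lia.
  by rewrite subnKC // => /(_ _)/eqP; apply; lia.
rewrite size_takel ?size_drop; last by lia.
move=> ltq; rewrite nth_take // nth_drop; apply/eqP/eq_w; lia.
Qed.

Arguments equal_blockP {w i j}.

(** A block fails to be maximal exactly when it can be extended by one letter,
    so only the two neighbouring letters matter. *)
Lemma is_runP (w : seq bool) (i j : nat) :
  reflect [/\ equal_block w i j,
              0 < i -> nth false w i.-1 <> nth false w i &
              j < size w -> nth false w j <> nth false w i]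
          (is_run w i j).
Proof.
apply: (iffP andP) => [[blk /forallP maxi] | [blk left right]].
  have [/andP[ltij lejw] eq_w] := equal_blockP blk.
  have {}maxi i' j' : i' <= i -> j <= j' -> equal_block w i' j' ->
      i' = i /\ j' = j.
    move=> lei lej blk'; have [/andP[ltij' lejw'] _] := equal_blockP blk'.
    have lti : i' < (size w).+1 by lia.
    have ltj : j' < (size w).+1 by lia.
    have /forallP/(_ (Ordinal ltj)) := maxi (Ordinal lti).
    by rewrite /= lei lej blk' /= => /andP[/eqP-> /eqP->].
  split=> // [i_gt0 | ltjw] eq_nbr.
    suff /(maxi _ _ (leq_pred i) (leqnn j))[] : equal_block w i.-1 j by lia.
    apply/equal_blockP; split; first by lia.
    move=> p /andP[lep ltp]; case: (leqP i p) => [leip | ltpi].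
      by rewrite eq_nbr eq_w ?leip.
    by congr nth; lia.
  suff /(maxi _ _ (leqnn i) (leqnSn j))[] : equal_block w i j.+1 by lia.
  apply/equal_blockP; split; first by lia.
  move=> p /andP[lep ltp]; case: (ltnP p j) => [ltpj | lejp].
    by rewrite eq_w ?lep.
  by have -> : p = j by lia.
split=> //; apply/forallP=> i'; apply/forallP=> j'; apply/implyP.
case/and3P=> lei lej blk'.
have [/andP[ltij lejw] _] := equal_blockP blk.
have [/andP[ltij' lejw'] eq_w'] := equal_blockP blk'.
apply/andP; split.
  case: ltngtP lei => // lti _; case: left; first by lia.
  by rewrite !eq_w' //; lia.
case: ltngtP lej => // ltj _; case: right; first by lia.
by rewrite !eq_w' //; lia.
Qed.

Arguments is_runP {w i j}.

Lemma runs_dvdP (a : bool) (k : nat) (w : seq bool) :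
  reflect (forall i j, is_run w i j -> nth false w i = a -> k %| j - i)
          (runs_dvd a k w).
Proof.
apply: (iffP forallP) => [dvd i j run eqa | dvd i]; last first.
  by apply/forallP=> j; apply/implyP=> /andP[run /eqP]; apply: dvd.
have [/equal_blockP[/andP[ltij lejw] _] _ _] := is_runP run.
have lti : i < (size w).+1 by lia.
have ltj : j < (size w).+1 by lia.
have /forallP/(_ (Ordinal ltj)) := dvd (Ordinal lti).
by rewrite /= run eqa eqxx.
Qed.

Arguments runs_dvdP {a k w}.

Lemma equal_block_shift (u v : seq bool) (i j : nat) :
  equal_block (u ++ v) (size u + i) (size u + j) = equal_block v i j.
Proof.
rewrite /equal_block ltn_add2l size_cat leq_add2l subnDl.
by rewrite [size u + i]addnC -drop_drop drop_size_cat.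
Qed.

Section LeadingRun.

Variables (b : bool) (l : nat) (v : seq bool).

(* The default value makes the empty word qualify. *)
Hypothesis head_v : head (~~ b) v = ~~ b.

Let nth_leading p : p < l -> nth false (nseq l b ++ v) p = b.
Proof. by move=> ltp; rewrite nth_cat size_nseq ltp nth_nseq ltp. Qed.

Let nth_rest p : nth false (nseq l b ++ v) (l + p) = nth false v p.
Proof. by rewrite nth_cat size_nseq -ltn_subRL subnn addKn. Qed.

Let nth_v0 : 0 < size v -> nth false v 0 = ~~ b.
Proof. by case: v head_v. Qed.

Let nth_l : 0 < size v -> nth false (nseq l b ++ v) l = ~~ b.
Proof. by move=> v_gt0; rewrite -nth_v0 // -nth_rest addn0. Qed.

Lemma is_run_leading : 0 < l -> is_run (nseq l b ++ v) 0 l.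
Proof.
move=> l_gt0; apply/is_runP; split=> //.
  apply/equal_blockP; rewrite size_cat size_nseq l_gt0 leq_addr.
  by split=> // p /= ltp; rewrite !nth_leading.
rewrite size_cat size_nseq => ltl; rewrite (nth_leading l_gt0) nth_l; last by lia.
by case: b.
Qed.

Lemma is_run_rest (i j : nat) :
  is_run (nseq l b ++ v) (l + i) (l + j) = is_run v i j.
Proof.
have blkE := equal_block_shift (nseq l b) v i j; rewrite size_nseq in blkE.
have nth_runE := (size_cat, size_nseq, ltn_add2l, nth_rest).
apply/is_runP/is_runP; rewrite blkE !nth_runE.
  case=> blk left right; split=> // i_gt0.
  have <- : nth false (nseq l b ++ v) (l + i).-1 = nth false v i.-1.
    by rewrite -nth_rest; congr nth; lia.
  by apply: left; lia.
case=> blk left right; split=> //.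
case: i blk left {right blkE} => [|i] blk left.
  have [/andP[lt0j lejv] _] := equal_blockP blk.
  rewrite addn0 => l_gt0; rewrite nth_leading ?nth_v0; [by case: b | lia | lia].
by move=> _; rewrite addnS /= nth_rest; apply: left.
Qed.

Lemma is_run_leading_uniq (i j : nat) :
  i < l -> is_run (nseq l b ++ v) i j -> i = 0 /\ j = l.
Proof.
move=> lti /is_runP[/equal_blockP[/andP[ltij lejw] eq_w] left right].
rewrite size_cat size_nseq in lejw right; rewrite nth_leading // in eq_w left right.
split.
  by case: i lti left {ltij eq_w right} => // i lti []; rewrite ?nth_leading //=; lia.
case: (ltngtP j l) => // [ltjl | ltlj].
  by case: right; [lia | rewrite nth_leading].
have := eq_w l; rewrite nth_l; last by lia.
by case: (b) => /(_ _)/esym; lia.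
Qed.

(** The runs of [nseq l b ++ v] are its leading run, if [l] is positive, and the
    runs of [v] moved by [l].  The case [l = 0] needs no exception because [k]
    divides 0. *)
Lemma runs_dvd_leading_run (a : bool) (k : nat) :
  runs_dvd a k (nseq l b ++ v) = ((b == a) ==> (k %| l)) && runs_dvd a k v.
Proof.
apply/runs_dvdP/andP=> [dvd | [/implyP dvdl /runs_dvdP dvdv] i j run eqa].
  split.
    apply/implyP=> /eqP eqba; case: (posnP l) => [-> // | l_gt0].
    by rewrite -[l]subn0; apply: dvd; rewrite ?is_run_leading ?nth_leading.
  apply/runs_dvdP=> i j run eqa; rewrite -(subnDl l).
  by apply: dvd; rewrite ?is_run_rest ?nth_rest.
case: (ltnP i l) => [lti | leli].
  have [i0 jl] := is_run_leading_uniq lti run.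
  rewrite i0 jl subn0; apply: dvdl; apply/eqP.
  by rewrite -eqa nth_leading.
have [/equal_blockP[/andP[ltij _] _] _ _] := is_runP run.
move: run eqa; rewrite -(subnKC leli) -(subnKC (leq_trans leli (ltnW ltij))).
by rewrite is_run_rest nth_rest subnDl; apply: dvdv.
Qed.

End LeadingRun.

Lemma leading_runE (b : bool) (w : seq bool) :
  exists l v, w = nseq l b ++ v /\ head (~~ b) v = ~~ b.
Proof.
elim: w => [|c w [l [v [-> head_v]]]]; first by exists 0, [::].
case: (eqVneq c b) => [-> | neq]; first by exists l.+1, v.
by exists 0, (c :: nseq l b ++ v); split=> //=; case: c b neq {head_v} => [] [].
Qed.

Lemma runs_dvd_prepend (a b : bool) (k m : nat) (w : seq bool) :
  (b == a) ==> (k %| m) -> runs_dvd a k (nseq m b ++ w) = runs_dvd a k w.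
Proof.
move=> /implyP dvdm; have [l [v [-> head_v]]] := leading_runE b w.
rewrite catA -nseqD !runs_dvd_leading_run //.
by case: eqP dvdm => //= _ /(_ isT) dvdm; rewrite dvdn_addr.
Qed.

(** * Good words and their tiles *)

Definition good (w : seq bool) : bool := runs_dvd false 2 w && runs_dvd true 3 w.

Definition tile (b : bool) : seq bool := nseq (if b then 3 else 2) b.

Lemma good_nil : good [::].
Proof.
by apply/andP; split; apply/runs_dvdP=> i j /is_runP[/equal_blockP[] /=]; lia.
Qed.

Lemma good_tile_cat (b : bool) (w : seq bool) : good (tile b ++ w) = good w.
Proof. by rewrite /good /tile; case: b; rewrite !runs_dvd_prepend. Qed.

(** The leading run is non-empty and its length is a multiple of that of the
    tile, so it contains the whole tile. *)
Lemma good_consP (b : bool) (w : seq bool) :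
  good (b :: w) -> exists2 w', good w' & b :: w = tile b ++ w'.
Proof.
move=> good_bw; suff [w' Dw]: exists w', b :: w = tile b ++ w'.
  by exists w' => //; rewrite -(good_tile_cat b) -Dw.
have [l [v [Dw head_v]]] := leading_runE b (b :: w).
suff le_tile : (if b then 3 else 2) <= l.
  exists (nseq (l - (if b then 3 else 2)) b ++ v).
  by rewrite Dw /tile catA -nseqD subnKC.
have l_gt0 : 0 < l.
  by case: l Dw => // Dv; rewrite -[v]Dv in head_v; case: b head_v {good_bw Dv}.
move: good_bw; rewrite Dw /good !runs_dvd_leading_run //.
by case: b {Dw head_v} => /andP[/andP[dvd2 _] /andP[dvd3 _]]; apply: dvdn_leq.
Qed.

(** * Counting *)

Lemma f0E (m : nat) : f0 m.+1 = #|[set w : m.-tuple bool | good w]|.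
Proof. by []. Qed.

Lemma f0_1 : f0 1 = 1.
Proof.
rewrite f0E -[RHS](cards1 [tuple of [::] : seq bool]); apply: eq_card => w.
by rewrite !inE tuple0 good_nil eqxx.
Qed.

Lemma f0_2 : f0 2 = 0.
Proof.
rewrite f0E; apply/eqP; rewrite cards_eq0 -subset0; apply/subsetP=> w.
rewrite inE => good_w; exfalso; move: good_w (size_tuple w).
case: (tval w) => // b s /good_consP[w' _ ->].
by rewrite size_cat /tile size_nseq; case: b; lia.
Qed.

Lemma f0_3 : f0 3 = 1.
Proof.
rewrite f0E -[RHS](cards1 [tuple false; false]); apply: eq_card => w.
rewrite !inE; apply/idP/eqP => [good_w | ->]; last first.
  by have := good_tile_cat false [::]; rewrite good_nil.
apply: val_inj => /=; move: good_w (size_tuple w).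
case: (tval w) => // b s /good_consP[w' _ ->].
by rewrite size_cat /tile size_nseq; case: b; case: w' => //=; lia.
Qed.

Definition cons_tile0 m (t : m.-tuple bool) : m.+2.-tuple bool :=
  [tuple of false :: false :: t].

Definition cons_tile1 m (t : m.-tuple bool) : m.+3.-tuple bool :=
  [tuple of true :: true :: true :: t].

Lemma f0_rec (m : nat) : f0 m.+4 = f0 m.+2 + f0 m.+1.
Proof.
rewrite !f0E.
rewrite -(card_imset _ (_ : injective (@cons_tile0 m.+1))); last first.
  by move=> s t [] /val_inj.
rewrite -(card_imset _ (_ : injective (@cons_tile1 m))); last first.
  by move=> s t [] /val_inj.
rewrite -cardsUI (_ : _ :&: _ = set0) ?cards0 ?addn0; last first.
  apply/setP=> w; rewrite !inE; apply/negP=> /andP[].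
  by case/imsetP=> s _ -> /imsetP[t _] [].
apply: eq_card => w; rewrite !inE; apply/idP/orP; last first.
  case=> /imsetP[t]; rewrite inE => good_t ->.
    by rewrite -(good_tile_cat false) in good_t.
  by rewrite -(good_tile_cat true) in good_t.
case/tupleP: w => b s /good_consP[w' good_w' Dw].
have szw : m.+3 = size (tile b) + size w'.
  by rewrite -size_cat -Dw /= size_tuple.
rewrite size_nseq in szw.
case: b Dw szw => Dw szw.
  have sz_w' : size w' == m by lia.
  right; apply/imsetP; exists (Tuple sz_w'); first by rewrite inE.
  exact: val_inj.
have sz_w' : size w' == m.+1 by lia.
left; apply/imsetP; exists (Tuple sz_w'); first by rewrite inE.
exact: val_inj.
Qed.

Lemma f0_padovan (m : nat) : f0 m.+1 = padovan m.+3.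
Proof.
(* The recurrence looks three steps back, so the induction carries three
   consecutive values. *)
suff [] : [/\ f0 m.+1 = padovan m.+3, f0 m.+2 = padovan m.+4
            & f0 m.+3 = padovan m.+4.+1] by [].
elim: m => [|m [IH1 IH2 IH3]]; first by rewrite f0_1 f0_2 f0_3.
by split=> //; rewrite f0_rec IH1 IH2.
Qed.

Theorem proposition13 :
  [/\ f0 1 = 1, f0 2 = 0, f0 3 = 1 &
      forall n : nat, 1 <= n -> f0 (n + 3) = f0 (n + 1) + f0 n] /\
  (forall n : nat, 1 <= n -> f0 n = padovan (n + 2)).
Proof.
split; first split; [exact: f0_1 | exact: f0_2 | exact: f0_3 | |].
  by case=> // m _; rewrite addn3 addn1 f0_rec.
by case=> // m _; rewrite addn2 f0_padovan.
Qed.
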